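(* Let $n\ge 1$ and let $a_1,\dots,a_n$ be integers with $a_n\ne 0$ such that the roots of the algebraic equation $$x^n=a_1x^{n-1}+a_2x^{n-2}+\dots+a_n$$ are pairwise distinct. Let $P_m/Q_m$ $(m\ge 1)$ be the $m$-th rational truncation of the 1-periodic recurrent fraction of order $n$ built from $a_1,\dots,a_n$. If there exists a finite nonzero real limit $$\lim_{m\to\infty}\frac{P_m}{Q_m}=x\neq 0,$$ then $x$ (the value of the recurrent fraction) is a real root of the equation, and its modulus is greater than the moduli of all the other roots of this equation.
   Context: Parapermanent. For a triangular table $A=(a_{ij})_{1\le j\le i\le N}$ put $\{a_{ij}\}=\prod_{k=j}^{i}a_{ik}$ (factorial product) and $$\mathrm{pper}(A)=\sum_{r=1}^{N}\ \sum_{p_1+\dots+p_r=N}\ \prod_{s=1}^{r}\{a_{p_1+\dots+p_s,\;p_1+\dots+p_{s-1}+1}\},$$ the inner sum running over positive integers $p_1,\dots,p_r$ with sum $N$; the parapermanent of the empty table is $1$. 1-periodic recurrent fraction. Given $a_1,\dots,a_n$, consider the infinite triangular table with entries $c_{ii}=a_1$, $c_{ij}=a_{i-j+1}/a_{i-j}$ for $1\le i-j\le n-1$, and $c_{ij}=0$ for $i-j\ge n$. (Factorial products $\{c_{ij}\}$ are evaluated by formal cancellation, so $\{c_{ij}\}=a_{i-j+1}$ for $i-j\le n-1$ and $\{c_{ij}\}=0$ for $i-j\ge n$.) Let $P_m$ be the parapermanent of the table formed by rows $1,\dots,m$, and let $Q_m$ be the parapermanent of the table of order $m-1$ obtained from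 it by deleting the first row and the first column ($Q_1=1$). The 1-periodic recurrent fraction of order $n$ is the formal quotient of the two corresponding infinite parapermanents, $P_m/Q_m$ is its $m$-th rational truncation, and its value is $\lim_{m\to\infty}P_m/Q_m$ when this finite limit exists. *)

(* Defs.v *)
From HB Require Import structures.
From mathcomp Require Import all_boot all_order all_algebra.
From mathcomp Require Import complex.

Set Implicit Arguments.
Unset Strict Implicit.
Unset Printing Implicit Defensive.

Import Order.TTheory GRing.Theory Num.Theory.

Local Open Scope ring_scope.

(* Triangular tables are functions [A : nat -> nat -> R] with rows and columns
   numbered from 1; only the entries [A i j] with [1 <= j <= i] are used. *)

Definition factprod (R : comNzRingType) (A : nat -> nat -> R) (i j : nat) : R :=
  \prod_(j <= k < i.+1) A i k.

(* The parapermanent of order [N] depends on the table only through its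
   factorial products [f i j].  It is defined from these, because the table of
   a recurrent fraction may have entries a_{k+1}/a_k with a_k = 0, for which
   only the factorial products (after formal cancellation) make sense.
   A composition p_1 + ... + p_r = N is a function [p] on ['I_r], whose value
   at [s] is p_{s+1}; hence "t <= s" below gives p_1 + ... + p_{s+1} and
   "t < s" gives p_1 + ... + p_s. *)
Definition pper_fp (R : comNzRingType) (f : nat -> nat -> R) (N : nat) : R :=
  if N == 0%N then 1 else
  \sum_(1 <= r < N.+1)
    \sum_(p : {ffun 'I_r -> 'I_N.+1} |
           [forall s, (0 < p s)%N] && ((\sum_(s < r) p s)%N == N))
      \prod_(s < r) f (\sum_(t < r | (t <= s)%N) p t)%N
                      (\sum_(t < r | (t < s)%N) p t)%N.+1.

Definition pper (R : comNzRingType) (A : nat -> nat -> R) (N : nat) : R :=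
  pper_fp (factprod A) N.

(* The table left after deleting the first row and the first column. *)
Definition del1 (R : Type) (A : nat -> nat -> R) : nat -> nat -> R :=
  fun i j => A i.+1 j.+1.

(* The coefficients a_1, ..., a_n are [a 1], ..., [a n]; the other values of
   [a] are never used when [0 < n]. *)
Definition rf_table (F : fieldType) (n : nat) (a : nat -> F) (i j : nat) : F :=
  if i == j then a 1%N
  else if (i - j < n)%N then a (i - j).+1 / a (i - j)%N else 0.

Definition rf_factprod (R : comNzRingType) (n : nat) (a : nat -> R)
    (i j : nat) : R :=
  if (i - j < n)%N then a (i - j).+1 else 0.

(* Deleting the first row and column shifts the factorial products in the same
   way as the entries, so [del1] applies to them as well. *)
Definition rf_P (R : comNzRingType) (n : nat) (a : nat -> R) (m : nat) : R :=
  pper_fp (rf_factprod n a) m.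

Definition rf_Q (R : comNzRingType) (n : nat) (a : nat -> R) (m : nat) : R :=
  pper_fp (del1 (rf_factprod n a)) m.-1.

(* Meaningful for [1 <= m].  When the denominator vanishes the quotient is 0 by
   convention; this cannot happen infinitely often along a sequence of
   truncations with a nonzero limit. *)
Definition rf_truncation (F : fieldType) (n : nat) (a : nat -> int) (m : nat) :
    F :=
  (rf_P n a m)%:~R / (rf_Q n a m)%:~R.

Definition rf_equation (R : nzRingType) (n : nat) (a : nat -> int) : {poly R} :=
  'X^n - \sum_(1 <= k < n.+1) (a k)%:~R *: 'X^(n - k).

(* Here [p] has degree [n] and is monic. *)
Definition pairwise_distinct_roots (F : closedFieldType) (n : nat)
    (p : {poly F}) : Prop :=
  exists z : n.-tuple F, p = \prod_(w <- z) ('X - w%:P) /\ uniq z.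

(* When no division by zero occurs in the table, [rf_P] and [rf_Q] are the
   parapermanents of the actual tables. *)
Lemma eq_pper_fp (R : comNzRingType) (f g : nat -> nat -> R) (N : nat) :
  (forall i j, (0 < j <= i)%N -> f i j = g i j) -> pper_fp f N = pper_fp g N.
Proof.
move=> fg; rewrite /pper_fp; case: ifP => // _.
apply: eq_bigr => r _; apply: eq_bigr => p /andP[/forallP p0 _].
apply: eq_bigr => s _; apply: fg => /=.
rewrite [leqRHS](bigD1 s) //= -add1n leq_add // leq_eqVlt; apply/orP; left.
by apply/eqP/eq_bigl => t; rewrite [LHS]ltn_neqAle andbC.
Qed.

Lemma factprod_rf_table (F : fieldType) (n : nat) (a : nat -> F) (i j : nat) :
    (0 < n)%N -> (forall k, (1 <= k < n)%N -> a k != 0) -> (j <= i)%N ->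
  factprod (rf_table n a) i j = rf_factprod n a i j.
Proof.
move=> n0 a0 ji; rewrite /factprod /rf_factprod.
rewrite -(subnK ji) addnK; move: (i - j)%N => d {ji i}.
case: ltnP => [|nd]; last first.
  rewrite big_ltn ?ltnS ?leq_addl // /rf_table addnK ltnNge nd /=.
  by rewrite gtn_eqF ?mul0r // -[X in (X < _)%N]add0n ltn_add2r (leq_trans n0).
elim: d j => [|d IH] j dn.
  by rewrite add0n big_nat1 /rf_table eqxx.
rewrite big_ltn ?ltnS ?leq_addl // addSnnS IH ?(ltnW dn) //.
rewrite /rf_table -addSnnS addnK dn gtn_eqF; last first.
  by rewrite addSn ltnS leq_addl.
by rewrite divfK // a0.
Qed.

Lemma rf_P_pper (F : fieldType) (n : nat) (a : nat -> F) (m : nat) :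
    (0 < n)%N -> (forall k, (1 <= k < n)%N -> a k != 0) ->
  rf_P n a m = pper (rf_table n a) m.
Proof.
move=> n0 a0; apply: eq_pper_fp => i j /andP[_ ji].
by rewrite factprod_rf_table.
Qed.

Lemma rf_Q_pper (F : fieldType) (n : nat) (a : nat -> F) (m : nat) :
    (0 < n)%N -> (forall k, (1 <= k < n)%N -> a k != 0) ->
  rf_Q n a m = pper (del1 (rf_table n a)) m.-1.
Proof.
move=> n0 a0; apply: eq_pper_fp => i j /andP[_ ji].
transitivity (factprod (rf_table n a) i.+1 j.+1).
  by rewrite factprod_rf_table.
by rewrite /factprod big_add1.
Qed.

(* Main.v *)
Require Import Defs.
From mathcomp Require Import all_boot all_order all_algebra.
From mathcomp Require Import complex zify.
From mathcomp Require Import all_classical all_reals all_analysis.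

Set Implicit Arguments.
Unset Strict Implicit.
Unset Printing Implicit Defensive.

Import Order.TTheory GRing.Theory Num.Theory.
Import numFieldNormedType.Exports.

Local Open Scope classical_set_scope.
Local Open Scope complex_scope.
Local Open Scope ring_scope.

(** With [u_m] the parapermanent of the first [m] rows, summing over the first
part of a composition shows that [u_0 = 1] and
[u_m = a_1 u_(m-1) + ... + a_n u_(m-n)], where [u] vanishes at negative indices.
Deleting the first row and column leaves the same table, so [Q_m = u_(m-1)] and
the truncations are the ratios [u_m / u_(m-1)].

Let [v] be [u] preceded by [n-1] zeros ([rf_seq]), so that the recurrence holds
from the very start, and let a polynomial [p] act on [v] through the shift
operator: [L_m(p) = sum_k p_k v_(m+k)] ([shift_eval]).  The polynomial [f] of the
equation gives [L_m(f) = 0].  If [z] is a root and [f = g (X - z)], then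
[L_(m+1)(g) = z L_m(g)], and [L_0(g) = 1] because [g] is monic of degree [n-1]
and [v] starts with [n-1] zeros and a 1.  Hence [L_m(g) = z^m]
([shift_eval_quotient]).

If [v_(m+1) / v_m] tends to a nonzero [x], then [L_m(p) / v_m] tends to [p(x)]
for every [p] of degree at most [n] ([cvg_shift_eval]).  With [p = f] this gives
[f(x) = 0].  With [p = g] it says that [z^m / v_m] tends to [g(x)].  For a root
[z <> x] this limit is 0, since [f(x) = g(x) (x - z)]; for [z = x] it is nonzero,
since [x] is a simple root.  Dividing, [(z / x)^m] tends to 0, that is,
[|z| < |x|].

The recurrence and the limits are studied over an arbitrary [numFieldType]: over
the reals they show that [x] is a root, over the complex numbers they compare it
with the other roots. *)

(** * Parapermanents of Toeplitz tables as sums over compositions *)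

Section WeightedCompositions.
Context (R : comNzRingType) (b : nat -> R).

(** The coefficient of [X^N] in the [r]-th power of the power series
[sum_k b_k X^k]. *)
Fixpoint comp_weight (r N : nat) : R :=
  if r is s.+1 then \sum_(k < N.+1) b k * comp_weight s (N - k)%N
  else (N == 0%N)%:R.

Lemma coef_exp_comp_weight (M r N : nat) : (N <= M)%N ->
  ((\poly_(k < M.+1) b k) ^+ r)`_N = comp_weight r N.
Proof.
elim: r N => [|r IH] N NM; first by rewrite expr0 coef1.
rewrite exprS coefM; apply: eq_bigr => k _.
rewrite coef_poly ltnS (leq_trans (leq_ord k) NM) IH //.
by rewrite (leq_trans (leq_subr k N)).
Qed.

(** Expanding the [r]-th power of a truncation of [sum_k b_k X^k] by
distributivity gives one monomial for each choice of [r] exponents. *)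
Lemma sum_comp_weight (r N : nat) :
  \sum_(p : {ffun 'I_r -> 'I_N.+1} | (\sum_(s < r) p s)%N == N)
     \prod_(s < r) b (p s) = comp_weight r N.
Proof.
rewrite -(@coef_exp_comp_weight N) // poly_def -[r in _ ^+ r]card_ord.
rewrite -prodr_const bigA_distr_bigA /= coef_sum [RHS]big_mkcond.
rewrite [LHS]big_mkcond; apply: eq_bigr => p _.
rewrite (eq_bigr (fun s => (b (p s))%:P * 'X^(p s))); last first.
  by move=> s _; rewrite mul_polyC.
rewrite big_split /= -rmorph_prod coefCM prodrXr coefXn.
by rewrite [N == _]eq_sym; case: ifP => _; rewrite ?mulr1 ?mulr0.
Qed.

Hypothesis b0 : b 0%N = 0.

(** Since [b 0 = 0], the [r]-th power of the series is divisible by [X^r]. *)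
Lemma comp_weight_gt (r N : nat) : (N < r)%N -> comp_weight r N = 0.
Proof.
elim: r N => [//|r IH] N Nr /=; apply: big1 => -[[|k] kN] _ /=.
  by rewrite b0 mul0r.
by rewrite IH ?mulr0 //; lia.
Qed.

(** As [b 0 = 0], this is the coefficient of [X^N] in [1 / (1 - B)], where
[B = sum_k b_k X^k]. *)
Definition total_weight (N : nat) : R := \sum_(r < N.+1) comp_weight r N.

Lemma total_weight_widen (M N : nat) : (N < M)%N ->
  total_weight N = \sum_(r < M) comp_weight r N.
Proof.
move=> NM; rewrite /total_weight (big_ord_widen _ (comp_weight^~ N) NM).
rewrite big_mkcond; apply: eq_bigr => r _.
by case: ltnP => // /comp_weight_gt ->.
Qed.

Lemma total_weight0 : total_weight 0 = 1.
Proof. by rewrite /total_weight big_ord1. Qed.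

Lemma total_weightS (N : nat) :
  total_weight N.+1 = \sum_(k < N.+1) b k.+1 * total_weight (N - k)%N.
Proof.
rewrite /total_weight big_ord_recl /= add0r.
under eq_bigr => r _ do rewrite big_ord_recl b0 mul0r add0r.
rewrite exchange_big; apply: eq_bigr => k _ /=.
rewrite -mulr_sumr -/(total_weight _) (@total_weight_widen N.+1) //.
by rewrite ltnS leq_subr.
Qed.

(** On a Toeplitz table of factorial products, the factor of a part depends only
on its length. *)
Lemma pper_fp_total_weight (f : nat -> nat -> R) (N : nat) :
  (forall i j, (j < i)%N -> f i j.+1 = b (i - j)%N) ->
  pper_fp f N = total_weight N.
Proof.
move=> fE; rewrite /pper_fp; case: eqP => [->|/eqP N0].
  by rewrite total_weight0.
rewrite /total_weight -[in RHS](big_mkord xpredT (comp_weight^~ N)).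
rewrite [RHS]big_ltn // [comp_weight 0 _]/= (negPf N0) add0r; apply: eq_bigr => r _.
rewrite -sum_comp_weight [LHS]big_mkcond [RHS]big_mkcond.
apply: eq_bigr => p _; case: (boolP [forall s, _]) => [/forallP p0|] /=.
  (* The row index of the part [s] exceeds the previous partial sum by [p s]. *)
  case: ifP => //= _; apply: eq_bigr => s _.
  have S : (\sum_(t < r | (t <= s)%N) p t =
            p s + \sum_(t < r | (t < s)%N) p t)%N.
    rewrite (bigD1 s) //=; congr addn; apply: eq_bigl => t.
    by rewrite [RHS]ltn_neqAle andbC.
  by rewrite S fE ?addnK // -[X in (X < _)%N]add0n ltn_add2r p0.
(* A zero part is excluded on one side and has weight [b 0 = 0] on the other. *)
case/forallPn => s; rewrite -eqn0Ngt => /eqP ps /=.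
by case: ifP => // _; rewrite (bigD1 s) //= ps b0 mul0r.
Qed.

End WeightedCompositions.

(** * The linear recurrence and the shift operator *)

Section Recurrence.
Context (K : numFieldType) (n : nat) (a : nat -> int).
Hypothesis n0 : (0 < n)%N.

Let b k : int := if (0 < k <= n)%N then a k else 0.

Lemma rf_P_total_weight m : rf_P n a m = total_weight b m.
Proof.
apply: pper_fp_total_weight => // i j ji.
by rewrite /rf_factprod /b -(subnSK ji).
Qed.

Lemma rf_Q_total_weight m : rf_Q n a m = total_weight b m.-1.
Proof.
apply: pper_fp_total_weight => // i j ji.
by rewrite /del1 /rf_factprod /b subSS -(subnSK ji).
Qed.

(** The [n.-1] leading zeros stand for the values at negative indices: they make
the recurrence of order [n] hold from index [0] on. *)
Definition rf_seq (m : nat) : K :=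
  if (m < n.-1)%N then 0 else (rf_P n a (m - n.-1))%:~R.

Lemma rf_seq_rec m :
  rf_seq (m + n) = \sum_(1 <= k < n.+1) (a k)%:~R * rf_seq (m + (n - k)).
Proof.
have nm : (n.-1 <= m + n)%N by rewrite (leq_trans (leq_pred n)) ?leq_addl.
have -> : rf_seq (m + n) = (total_weight b m.+1)%:~R.
  rewrite /rf_seq ltnNge nm /= rf_P_total_weight; congr (total_weight b _)%:~R.
  by rewrite -{1}(prednK n0) addnS -addSn addnK.
rewrite total_weightS // rmorph_sum big_add1 big_mkord /=.
(* The sums run over [k <= m] and [k < n].  Both are extended by zeros to a
   common range: for [k >= n] the weight [b k.+1] is zero, for [k > m] the
   sequence [rf_seq] is. *)
set M := (m.+1 + n)%N.
rewrite (big_ord_widen M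
  (fun k => (b k.+1 * total_weight b (m - k))%:~R)) ?leq_addr //.
rewrite (big_ord_widen M
  (fun k => (a k.+1)%:~R * rf_seq (m + (n - k.+1)))) ?leq_addl //.
rewrite [LHS]big_mkcond [RHS]big_mkcond; apply: eq_bigr => k _ /=.
rewrite /b /=; case: (ltnP k n) => kn; last by rewrite mul0r if_same.
rewrite rmorphM /rf_seq.
have -> : (m + (n - k.+1) < n.-1)%N = ~~ (k < m.+1)%N.
  by rewrite -ltnNge; apply/idP/idP; lia.
case: ltnP => km /=; last by rewrite mulr0.
rewrite rf_P_total_weight; congr (_ * (total_weight b _)%:~R); lia.
Qed.

Definition shift_eval (m : nat) (p : {poly K}) : K :=
  \sum_(k < n.+1) p`_k * rf_seq (m + k).

Lemma shift_evalB m p q :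
  shift_eval m (p - q) = shift_eval m p - shift_eval m q.
Proof.
by rewrite /shift_eval -sumrB; apply: eq_bigr => k _; rewrite coefB mulrBl.
Qed.

Lemma shift_evalZ m c p : shift_eval m (c *: p) = c * shift_eval m p.
Proof.
by rewrite /shift_eval mulr_sumr; apply: eq_bigr => k _; rewrite coefZ mulrA.
Qed.

Lemma shift_evalMX m (p : {poly K}) : (size p <= n)%N ->
  shift_eval m (p * 'X) = shift_eval m.+1 p.
Proof.
move=> sp; rewrite /shift_eval big_ord_recl coefMX mul0r add0r.
rewrite [RHS]big_ord_recr /= (nth_default _ sp) mul0r addr0.
by apply: eq_bigr => k _; rewrite coefMX /= addSnnS.
Qed.

Lemma shift_evalXn m k : (k <= n)%N -> shift_eval m 'X^k = rf_seq (m + k).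
Proof.
rewrite -ltnS => kn; rewrite /shift_eval (bigD1 (Ordinal kn)) //=.
rewrite coefXn eqxx mul1r big1 ?addr0 // => i ik.
rewrite coefXn; case: eqP => [e|_]; last by rewrite mul0r.
by case/eqP: ik; apply: val_inj.
Qed.

(** The recurrence says that the polynomial of the equation annihilates the
sequence. *)
Lemma shift_eval_equation m : shift_eval m (rf_equation K n a) = 0.
Proof.
rewrite /rf_equation shift_evalB shift_evalXn // rf_seq_rec; apply/eqP.
rewrite subr_eq0; apply/eqP; rewrite /shift_eval.
under [RHS]eq_bigr => i _ do rewrite coef_sum mulr_suml.
rewrite exchange_big; apply: eq_big_nat => k /andP[_ kn] /=.
rewrite -shift_evalXn ?leq_subr // -shift_evalZ.
by apply: eq_bigr.
Qed.

Lemma size_monic_rf_equation :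
  size (rf_equation K n a) = n.+1 /\ rf_equation K n a \is monic.
Proof.
have sz : (size (- \sum_(1 <= k < n.+1) (a k)%:~R *: 'X^(n - k) : {poly K})
           < size ('X^n : {poly K}))%N.
  rewrite size_polyXn size_polyN; apply: (leq_ltn_trans (n := n)) => //.
  rewrite big_nat; elim/big_ind: _ => [|p q|k /andP[k0 kn]].
  - by rewrite size_poly0.
  - by move=> sp sq; rewrite (leq_trans (size_polyD _ _)) // geq_max sp.
  - by rewrite (leq_trans (size_scale_leq _ _)) // size_polyXn; lia.
split; first by rewrite /rf_equation size_polyDl // size_polyXn.
by rewrite monicE lead_coefDl // lead_coefXn.
Qed.

(** The quotient [g] of the equation by [X - z] turns the sequence into one
annihilated by [X - z], hence geometric of ratio [z].  Its first term is 1: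
among the [n] values combined at [m = 0], only the last is nonzero, it equals 1,
and it is multiplied by the leading coefficient of [g]. *)
Lemma shift_eval_quotient z g m :
  rf_equation K n a = g * ('X - z%:P) -> shift_eval m g = z ^+ m.
Proof.
move=> fE; have [sf mf] := size_monic_rf_equation.
have mg : g \is monic by rewrite fE monicMr ?monicXsubC in mf.
have sg : size g = n.
  by move: sf; rewrite fE size_Mmonic ?monicXsubC ?monic_neq0 // size_XsubC addn2 => -[].
elim: m => [|m IH].
  rewrite /shift_eval big_ord_recr /= nth_default ?sg // mul0r addr0.
  rewrite -(prednK n0) big_ord_recr /= big1 => [|i _]; last first.
    by rewrite /rf_seq add0n ltn_ord mulr0.
  have := mg; rewrite monicE lead_coefE sg => /eqP ->.
  by rewrite /rf_seq add0n ltnn subnn rf_P_total_weight total_weight0 mulr1 expr0 add0r.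
rewrite exprS -IH; apply/eqP; rewrite -subr_eq0 -shift_evalMX ?sg //.
rewrite -shift_evalZ -shift_evalB.
by rewrite -mul_polyC [z%:P * g]mulrC -mulrBr -fE shift_eval_equation.
Qed.

End Recurrence.

(** * Limits of ratios *)

Section Limits.
Context (K : numFieldType).

Lemma near_denominator_neq0 (u v : nat -> K) (l : K) : l != 0 ->
  (fun m => u m / v m) @ \oo --> l -> \forall m \near \oo, v m != 0.
Proof.
move=> l0 uvl; apply: filterS (cvgr_neq0 _ uvl l0) => m.
by rewrite mulf_eq0 invr_eq0 negb_or => /andP[].
Qed.

(** The ratio of terms at distance [k] is a product of [k] consecutive ratios. *)
Lemma cvg_ratio_shift (v : nat -> K) (x : K) (k : nat) : x != 0 ->
    (fun m => v m.+1 / v m) @ \oo --> x ->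
  (fun m => v (m + k)%N / v m) @ \oo --> x ^+ k.
Proof.
move=> x0 vx; have v0 := near_denominator_neq0 x0 vx.
elim: k => [|k IH].
  rewrite expr0; apply: cvg_near_cst; apply: filterS v0 => m vm.
  by rewrite addn0 divff.
have vk : (fun m => v (m + k).+1 / v (m + k)%N) @ \oo --> x.
  by move: vx; rewrite -(cvg_shiftn k).
have vk0 := near_denominator_neq0 x0 vk.
rewrite exprS; apply: cvg_trans (cvgM vk IH); apply: near_eq_cvg.
apply: filterS vk0 => m vm.
by rewrite /= mulrA divfK // addnS.
Qed.

(** If [|z| >= |x|], all the quotients [z^m / x^m] have modulus at least 1. *)
Lemma cvg_exp_lt (z x : K) : x != 0 ->
  (fun m => z ^+ m / x ^+ m) @ \oo --> (0 : K) -> `|z| < `|x|.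
Proof.
move=> x0 zx; rewrite real_ltNge ?normr_real //; apply/negP => xz.
have [m _ /(_ m (leqnn m))] : \forall m \near \oo, `|0 - z ^+ m / x ^+ m| < 1.
  by move/cvgrPdist_lt: zx; apply.
rewrite /= sub0r normrN normrM normfV !normrX ltr_pdivrMr ?exprn_gt0 ?normr_gt0 //.
rewrite mul1r => /lt_geF/negP; apply.
by apply: lerXn2r; rewrite ?nnegrE ?normr_ge0.
Qed.

Variables (n : nat) (a : nat -> int) (x : K).
Hypotheses (n0 : (0 < n)%N) (x0 : x != 0).
Hypothesis cvx : (fun m => rf_truncation K n a m) @ \oo --> x.

Let v := rf_seq K n a.

Lemma cvg_rf_seq_ratio : (fun m => v m.+1 / v m) @ \oo --> x.
Proof.
have vE m : v (m + n.-1) = (rf_P n a m)%:~R.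
  by rewrite /v /rf_seq ltnNge leq_addl addnK.
rewrite -(cvg_shiftn n.-1); have := cvx; rewrite -[X in X -> _]cvg_shiftS.
apply: cvg_trans; apply: near_eq_cvg; apply: nearW => m.
rewrite /= /rf_truncation -[(m + n.-1).+1]addSn !vE.
by rewrite rf_Q_total_weight // !rf_P_total_weight.
Qed.

Lemma cvg_shift_eval (p : {poly K}) : (size p <= n.+1)%N ->
  (fun m => shift_eval n a m p / v m) @ \oo --> p.[x].
Proof.
move=> sp; rewrite (horner_coef_wide _ sp).
have -> : (fun m => shift_eval n a m p / v m) =
          (fun m => \sum_(k < n.+1) p`_k * (v (m + k)%N / v m)).
  apply/funext => m; rewrite mulr_suml.
  by apply: eq_bigr => k _; rewrite mulrA.
apply: cvg_big => [|k _]; first exact: add_continuous.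
by apply: cvgMl_tmp; apply: cvg_ratio_shift cvg_rf_seq_ratio.
Qed.

Lemma root_rf_limit : root (rf_equation K n a) x.
Proof.
have [sf _] := size_monic_rf_equation K a n0.
have := @cvg_shift_eval (rf_equation K n a); rewrite sf => /(_ (leqnn _)).
under eq_fun do rewrite shift_eval_equation // mul0r.
by move/(norm_cvg_unique (cvg_cst (0 : K)))/esym/eqP.
Qed.

(** Both [z^m] and [x^m], divided by the sequence, converge by
[shift_eval_quotient], to 0 and to a nonzero number, so [z^m / x^m] tends
to 0. The hypothesis on the quotients [g] expresses that the root [x] is
simple. *)
Lemma rf_limit_dominates (z : K) :
    (forall g, rf_equation K n a = g * ('X - x%:P) -> g.[x] != 0) ->
  root (rf_equation K n a) z -> z != x -> `|z| < `|x|.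
Proof.
move=> simple_x rz zx; have [sf mf] := size_monic_rf_equation K a n0.
have lim w g : rf_equation K n a = g * ('X - w%:P) ->
    (fun m => w ^+ m / v m) @ \oo --> g.[x].
  move=> fE.
  have sg : (size g <= n.+1)%N.
    rewrite -sf fE size_Mmonic ?monicXsubC ?size_XsubC ?addn2 //.
    by apply: contraTneq mf => g0; rewrite fE g0 mul0r monicE lead_coef0 eq_sym oner_eq0.
  have := cvg_shift_eval sg.
  by under eq_fun do rewrite (shift_eval_quotient n0 _ fE).
have /factor_theorem[g gE] := rz.
have /factor_theorem[h hE] := root_rf_limit.
have gx : g.[x] = 0.
  have := root_rf_limit; rewrite gE rootM root_XsubC eq_sym (negPf zx) orbF.
  exact: eqP.
have hx := simple_x _ hE.
apply: cvg_exp_lt => //.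
have -> : (0 : K) = g.[x] / h.[x] by rewrite gx mul0r.
apply: cvg_trans (cvgM (lim _ _ gE) (cvgV hx (lim _ _ hE))).
apply: near_eq_cvg; have := near_denominator_neq0 hx (lim _ _ hE).
apply: filterS => m vm /=.
by rewrite invf_div mulrA divfK.
Qed.

End Limits.

(** * The real and complex numbers *)

Lemma simple_root_quotient (F : closedFieldType) (n : nat) (p g : {poly F}) (x : F) :
    pairwise_distinct_roots n p -> root p x -> p = g * ('X - x%:P) ->
  g.[x] != 0.
Proof.
case=> z [-> uz]; rewrite root_prod_XsubC => xz.
rewrite (perm_big _ (perm_to_rem xz)) big_cons [g * _]mulrC /= => /mulfI <-.
  by rewrite -[_ != 0]/(~~ root _ x) root_prod_XsubC mem_rem_uniq // inE eqxx.
by rewrite polyXsubC_eq0.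
Qed.

(** The cast to [numFieldType] selects the topology that every such field gets
from its norm. *)
Lemma cvg_real_complex (R : realType) (u : nat -> R) (x : R) :
  u @ \oo --> x ->
  (fun m => (u m)%:C : (R[i] : numFieldType)) @ \oo -->
    (x%:C : (R[i] : numFieldType)).
Proof.
move=> /cvgrPdist_lt ux; apply/cvgrPdist_lt => e e0.
have eE : e = (complex.Re e)%:C by rewrite RRe_real // gtr0_real.
have := ux (complex.Re e); rewrite -(ltcR 0) -eE => /(_ e0).
apply: filterS => m; rewrite -ltcR -eE => h.
by rewrite -rmorphB normc_def /= expr0n addr0 sqrtr_sqr.
Qed.

Unset Implicit Arguments.

Theorem mainTheorem1 (R : realType) (n : nat) (a : nat -> int) (x : R) :
  (1 <= n)%N ->
  a n != 0 ->
  pairwise_distinct_roots n (rf_equation R[i] n a) ->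
  (fun m : nat => rf_truncation R n a m) @ \oo --> x ->
  x != 0 ->
  root (rf_equation R n a) x /\
  (forall z : R[i], root (rf_equation R[i] n a) z -> z != x%:C ->
     `|z| < `|x%:C|).
Proof.
move=> n0 _ distinct cvx x0; split; first exact: root_rf_limit cvx.
have xC0 : x%:C != 0 :> R[i] by rewrite fmorph_eq0.
have cvxC : (fun m => rf_truncation (R[i] : numFieldType) n a m) @ \oo -->
    (x%:C : (R[i] : numFieldType)).
  have -> : (fun m => rf_truncation R[i] n a m) =
            (fun m => (rf_truncation R n a m)%:C).
    by apply/funext => m; rewrite fmorph_div !rmorph_int.
  exact: cvg_real_complex.
move=> z; apply: (rf_limit_dominates n0 xC0 cvxC) => g.
exact: simple_root_quotient distinct (root_rf_limit n0 xC0 cvxC).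
Qed.
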